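(* Let $M$ be a simple matroid of rank $3$ on a ground set $E$ of size $n$. The Chern numbers $\overline{c}_1^2(M)$ and $\overline{c}_2(M)$ satisfy $$0\leq \overline{c}_1^2(M)\leq \overline{c}_1^2(U_{3,n})\quad\text{and}\quad 0\leq \overline{c}_2(M)\leq\overline{c}_2(U_{3,n}),$$ where $U_{3,n}$ is the uniform matroid of rank $3$ on $n$ elements.
   Context: Matroid notions. For a matroid $M$ with rank function $r$ on a finite set $E$, a flat is a subset $F\subseteq E$ with $r(F\cup\{j\})>r(F)$ for all $j\in E\setminus F$; a loop is an element $i$ with $r(\{i\})=0$; distinct $i,j$ are parallel if $r(\{i,j\})=1$. $M$ is simple if it has neither loops nor parallel points. For $S\subseteq E$, $M|S$ is the restriction to $S$, and $M/S$ is the contraction, on $E\setminus S$, with rank function $T\mapsto r(T\cup S)-r(S)$. The beta invariant is $\beta(M)=(-1)^{r(E)}\sum_{S\subseteq E}(-1)^{|S|}r(S)$. The uniform matroid $U_{3,n}$ has rank function $r(S)=\min(|S|,3)$ on a set of size $n$. Bergman fan. Let $M$ be a loopless matroid of rank $d+1$ on $E$ (here $d=2$). Let $N=\mathbb{Z}^E/\mathbb{Z}\mathbf{1}$ with $\mathbf 1=\sum_{i\in E}e_i$, let $u_i$ be the image of $e_i$ in $N$ and $u_S=\sum_{i\in S}u_i$. The Bergman fan $\Sigma_M$ is the pure $d$-dimensional fan in $N\otimes\mathbb{R}$ with cones $\sigma_{\mathcal F}=\mathrm{Cone}(u_{F_1},\dots,u_{F_k})$ for each chain of flats $\mathcal F:\emptyset\subsetneq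 F_1\subsetneq\cdots\subsetneq F_k\subsetneq E$. Minkowski weights. $MW_k(\Sigma_M)$ is the group of integer-valued functions $\omega$ on the $k$-dimensional cones of $\Sigma_M$ satisfying the balancing condition: for every $(k-1)$-dimensional cone $\tau$, $\sum_{F}\omega(\tau+\mathbb{R}_{\ge 0}u_F)\,u_F\in \mathrm{span}(\tau)$, the sum running over flats $F$ such that $\tau+\mathbb{R}_{\ge0}u_F$ is a $k$-dimensional cone of $\Sigma_M$. Product: let $A^*(M)=\mathbb{Z}[x_F: F \text{ a nonempty proper flat}]/(I+J)$, where $I$ is generated by the $x_Fx_G$ with $F,G$ incomparable and $J$ by $\sum_{F\ni i}x_F-\sum_{F\ni j}x_F$ for $i,j\in E$, and let $\deg:A^d(M)\to\mathbb{Z}$ be the isomorphism with $\deg(x_{F_1}\cdots x_{F_d})=1$ for every maximal chain $\emptyset\subsetneq F_1\subsetneq\cdots\subsetneq F_d\subsetneq E$. For each $k$ the map $A^{d-k}(M)\to MW_k(\Sigma_M)$ sending $a$ to $\sigma_{\mathcal F}\mapsto \deg(a\,x_{F_1}\cdots x_{F_k})$ is an isomorphism, and the product $MW_k(\Sigma_M)\times MW_l(\Sigma_M)\to MW_{k+l-d}(\Sigma_M)$ is the one transported from $A^*(M)$. The isomorphism $\mathrm{w}:MW_0(\Sigma_M)\to\mathbb{Z}$ returns the weight of the vertex. CSM cycles. For $0\le k\le d$, $\mathrm{csm}_k(M)\in MW_k(\Sigma_M)$ is the Minkowski weight given by $\omega(\sigma_{\mathcal F})=(-1)^{d-k}\prod_{i=0}^k\beta(M|F_{i+1}/F_i)$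 for a chain $\mathcal F:\emptyset=F_0\subsetneq F_1\subsetneq\cdots\subsetneq F_k\subsetneq F_{k+1}=E$. Chern numbers. For $M$ of rank $3$ (so $d=2$), the Chern numbers are $\overline c_1^2(M)=\mathrm{w}(\mathrm{csm}_1(M)\cdot\mathrm{csm}_1(M))$ and $\overline c_2(M)=\mathrm{w}(\mathrm{csm}_0(M))$. *)

(* Defs.v *)
From HB Require Import structures.
From Stdlib Require Import ClassicalEpsilon.
From mathcomp Require Import all_boot all_order all_algebra.
From mathcomp Require Import ring_quotient mpoly boolp.

Set Implicit Arguments.
Unset Strict Implicit.
Unset Printing Implicit Defensive.

Import GRing.Theory.
Local Open Scope ring_scope.
Local Open Scope quotient_scope.

(* The ground set is a subset of an ambient finite type, so that minors of a
   matroid live on the same type. Only the values of [rk] on subsets of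
   [ground] are meaningful. *)
Record matroid (T : finType) := Matroid {
  ground : {set T};
  rk : {set T} -> nat;
  rk_card : forall A : {set T}, A \subset ground -> (rk A <= #|A|)%N;
  rk_mono : forall A B : {set T},
    A \subset B -> B \subset ground -> (rk A <= rk B)%N;
  rk_submod : forall A B : {set T}, A \subset ground -> B \subset ground ->
    (rk (A :|: B) + rk (A :&: B) <= rk A + rk B)%N
}.

Section Matroids.
Variables (T : finType) (M : matroid T).
Implicit Types (A B S F : {set T}) (i j : T).

Definition rank : nat := rk M (ground M).

Definition flat F : bool :=
  (F \subset ground M) &&
  [forall j in ground M :\: F, (rk M F < rk M (j |: F))%N].

Definition loop i : bool := (i \in ground M) && (rk M [set i] == 0%N).

Definition parallel i j : bool :=
  [&& i \in ground M, j \in ground M, i != j & rk M [set i; j] == 1%N].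

Definition simple_matroid : Prop :=
  (forall i, ~~ loop i) /\ (forall i j, ~~ parallel i j).

Definition beta : int :=
  (-1) ^+ rank * \sum_(S : {set T} | S \subset ground M)
                    (-1) ^+ #|S| * (rk M S)%:R.

Section Restriction.
Variable S : {set T}.

Fact restriction_card A : A \subset ground M :&: S -> (rk M A <= #|A|)%N.
Proof. by rewrite subsetI => /andP[AE _]; apply: rk_card. Qed.

Fact restriction_mono A B :
  A \subset B -> B \subset ground M :&: S -> (rk M A <= rk M B)%N.
Proof. by rewrite subsetI => AB /andP[BE _]; apply: rk_mono. Qed.

Fact restriction_submod A B :
  A \subset ground M :&: S -> B \subset ground M :&: S ->
  (rk M (A :|: B) + rk M (A :&: B) <= rk M A + rk M B)%N.
Proof.
by rewrite !subsetI => /andP[AE _] /andP[BE _]; apply: rk_submod.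
Qed.

Definition restriction : matroid T :=
  Matroid restriction_card restriction_mono restriction_submod.

End Restriction.

Section Contraction.
Variable S : {set T}.

(* [ground M :&: S] is [S] in the meaningful case [S \subset ground M]. *)
Let S' := ground M :&: S.

Definition contraction_rk A : nat := (rk M (A :|: S') - rk M S')%N.

Let S'E : S' \subset ground M. Proof. exact: subsetIl. Qed.

Let US'E A : A \subset ground M :\: S -> A :|: S' \subset ground M.
Proof.
by move=> /subset_trans/(_ (subsetDl _ _)) AE; rewrite subUset AE S'E.
Qed.

Fact contraction_card A :
  A \subset ground M :\: S -> (contraction_rk A <= #|A|)%N.
Proof.
move=> AE; rewrite leq_subLR.
have AE' : A \subset ground M := subset_trans AE (subsetDl _ _).
apply: leq_trans (leq_add (leqnn _) (rk_card AE')).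
by rewrite addnC; apply: leq_trans (rk_submod AE' S'E); apply: leq_addr.
Qed.

Fact contraction_mono A B : A \subset B -> B \subset ground M :\: S ->
  (contraction_rk A <= contraction_rk B)%N.
Proof.
by move=> AB BE; apply/leq_sub2r/rk_mono; [apply: setSU | apply: US'E].
Qed.

Fact contraction_submod A B :
  A \subset ground M :\: S -> B \subset ground M :\: S ->
  (contraction_rk (A :|: B) + contraction_rk (A :&: B)
     <= contraction_rk A + contraction_rk B)%N.
Proof.
move=> AE BE; have := rk_submod (US'E AE) (US'E BE).
have h A0 : A0 \subset ground M :\: S -> (rk M S' <= rk M (A0 :|: S'))%N.
  by move=> hA; apply: rk_mono (US'E hA); apply: subsetUr.
rewrite -setUIl setUACA setUid => le_rk.
rewrite -(leq_add2r (rk M S' + rk M S')%N) !(addnACA _ _ (rk M S')) !subnK ?h //.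
  exact: subset_trans (subsetIl _ _) AE.
by rewrite subUset AE BE.
Qed.

Definition contraction : matroid T :=
  Matroid contraction_card contraction_mono contraction_submod.

End Contraction.

End Matroids.

Section Uniform.
Variables k n : nat.
Implicit Types A B : {set 'I_n}.

Definition uniform_rk A : nat := minn #|A| k.

Fact uniform_card A : A \subset [set: 'I_n] -> (uniform_rk A <= #|A|)%N.
Proof. by move=> _; apply: geq_minl. Qed.

Fact uniform_mono A B : A \subset B -> B \subset [set: 'I_n] ->
  (uniform_rk A <= uniform_rk B)%N.
Proof.
move=> /subset_leq_card AB _.
by rewrite /uniform_rk leq_min geq_minr andbT geq_min AB.
Qed.

Fact uniform_submod A B : A \subset [set: 'I_n] -> B \subset [set: 'I_n] ->
  (uniform_rk (A :|: B) + uniform_rk (A :&: B)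
     <= uniform_rk A + uniform_rk B)%N.
Proof.
move=> _ _; rewrite /uniform_rk.
have e := cardsUI A B.
have hA := subset_leq_card (subsetIl A B).
have hB := subset_leq_card (subsetIr A B).
case: (leqP #|A| k) => hAk; case: (leqP #|B| k) => hBk.
- by rewrite -e leq_add // geq_minl.
- by rewrite addnC leq_add ?geq_minr // geq_min hA.
- by rewrite leq_add ?geq_minr // geq_min hB.
- by rewrite leq_add // geq_minr.
Qed.

Definition uniform_matroid : matroid 'I_n :=
  Matroid uniform_card uniform_mono uniform_submod.

End Uniform.

Inductive ideal_gen (R : comNzRingType) (G : R -> Prop) : R -> Prop :=
| ideal_gen0 : ideal_gen G 0
| ideal_genD q g p : G g -> ideal_gen G p -> ideal_gen G (q * g + p).

Section Chow.
Variables (T : finType) (M : matroid T).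

(* d, where d + 1 is the rank *)
Definition dimM : nat := (rank M).-1.

Definition pflat : finType :=
  {F : {set T} | [&& flat M F, F != set0 & F != ground M]}.

Definition chow_poly := {mpoly int[#|pflat|]}.

Definition xvar (F : pflat) : chow_poly := 'X_(enum_rank F).

Inductive chow_rel : chow_poly -> Prop :=
| chow_incomparable (F G : pflat) :
    ~~ (val F \subset val G) -> ~~ (val G \subset val F) ->
    chow_rel (xvar F * xvar G)
| chow_linear (i j : T) : i \in ground M -> j \in ground M ->
    chow_rel (\sum_(F : pflat | i \in val F) xvar F
              - \sum_(F : pflat | j \in val F) xvar F).

Definition chow_ideal : {pred chow_poly} :=
  fun p => `[< ideal_gen chow_rel p >].

Let chow_idealP p : reflect (ideal_gen chow_rel p) (p \in chow_ideal).
Proof. exact: asboolP. Qed.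

Let ideal_genDD p q : ideal_gen chow_rel p -> ideal_gen chow_rel q ->
  ideal_gen chow_rel (p + q).
Proof.
by move=> hp hq; elim: hp => [|c g r hg _ IH]; rewrite ?add0r // -addrA;
   constructor.
Qed.

Let ideal_genM a p : ideal_gen chow_rel p -> ideal_gen chow_rel (a * p).
Proof.
elim=> [|c g r hg _ IH]; first by rewrite mulr0; constructor.
by rewrite mulrDr mulrA; constructor.
Qed.

(* all generators vanish at the origin *)
Let ideal_gen_ev0 p : ideal_gen chow_rel p -> p.@[fun=> 0] = 0.
Proof.
have ev_sum (P : pred pflat) : (\sum_(F | P F) xvar F).@[fun=> 0] = 0.
  elim/big_rec: _ => [|F q _ IH]; first by rewrite meval0.
  by rewrite mevalD /xvar mevalXU add0r.
elim=> [|c g r hg _ IH]; first by rewrite meval0.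
rewrite mevalD mevalM IH addr0; case: hg => [F G _ _|i j _ _].
  by rewrite mevalM /xvar !mevalXU mul0r mulr0.
by rewrite mevalB !ev_sum subrr mulr0.
Qed.

Fact chow_ideal_closed : idealr_closed chow_ideal.
Proof.
split.
- by apply/chow_idealP; constructor.
- by apply/negP => /chow_idealP/ideal_gen_ev0 /eqP; rewrite meval1 oner_eq0.
- move=> a u v /chow_idealP hu /chow_idealP hv; apply/chow_idealP.
  by apply: ideal_genDD => //; apply: ideal_genM.
Qed.

HB.instance Definition _ :=
  isIdealr.Build chow_poly chow_ideal chow_ideal_closed.

Definition chow := {ideal_quot chow_ideal}.

Definition chow_pi (p : chow_poly) : chow := \pi_chow p.

Definition chow_homog (k : nat) (a : chow) : Prop :=
  exists2 p : chow_poly, p \is k.-homog & a = chow_pi p.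

(* The [k]-dimensional cones of the Bergman fan, each given by the flag of
   flats spanning its rays: the fan is simplicial and distinct flags span
   distinct cones. *)
Definition cone (k : nat) : finType :=
  {s : k.-tuple pflat | sorted (fun F G : pflat => val F \proper val G) (val s)}.

Definition cone_flats k (s : cone k) : seq pflat := val (val s).

Definition vertex : cone 0 := exist _ [tuple] isT.

Definition chow_monom k (s : cone k) : chow :=
  \prod_(F <- cone_flats s) chow_pi (xvar F).

(* The degree map A^d -> Z, extended by zero to the other graded pieces. These
   conditions determine it, as the monomials of maximal flags generate A^d;
   existence is a theorem. *)
Definition is_degree_map (f : chow -> int) : Prop :=
  [/\ forall a b, f (a + b) = f a + f b,
      forall k a, k != dimM -> chow_homog k a -> f a = 0
    & forall s : cone dimM, f (chow_monom s) = 1].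

Definition deg : chow -> int := epsilon (inhabits (fun=> 0)) is_degree_map.

(* [u_vec S] is the integral lift of the vector u_S of N = Z^E / Z 1_E, viewed
   in Q^T; [cone_span s] is the preimage in Q^T of the span of the cone [s],
   whence the generator [u_vec (ground M)]. Rational coefficients are enough,
   since an integral vector lies in the real span of integral vectors if and
   only if it lies in their rational span. *)
Definition u_vec (S : {set T}) : {ffun T -> rat^o} := [ffun i => (i \in S)%:R].

Definition cone_span k (s : cone k) : {vspace {ffun T -> rat^o}} :=
  <<u_vec (ground M) :: [seq u_vec (val F) | F <- cone_flats s]>>%VS.

(* For given [t] and [F] the inner sum has at most one term: the cone [s]
   equal to [t] plus the ray of [F], if it exists. *)
Definition balanced k (w : {ffun cone k -> int}) : Prop :=
  forall j (t : cone j), k = j.+1 ->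
    \sum_(F : pflat)
      \sum_(s : cone k | perm_eq (cone_flats s) (F :: cone_flats t))
        (w s)%:~R *: u_vec (val F) \in cone_span t.

Record MW (k : nat) := MinkowskiWeight {
  mw_fun :> {ffun cone k -> int};
  mw_balanced : balanced mw_fun
}.

Fact balanced0 k : balanced ([ffun=> 0] : {ffun cone k -> int}).
Proof.
move=> j t _; rewrite big1 ?mem0v // => F _; rewrite big1 // => s _.
by rewrite ffunE scale0r.
Qed.

Definition MW_zero k : MW k := MinkowskiWeight (@balanced0 k).

(* [w] is the image of [a] under the isomorphism A^(d-k) -> MW_k *)
Definition represents k (a : chow) (w : MW k) : Prop :=
  chow_homog (dimM - k) a /\ forall s, w s = deg (a * chow_monom s).

(* The product MW_k x MW_l -> MW_m, meant for m = k + l - d; [z] exists and is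
   unique then, since the maps A^(d-k) -> MW_k are isomorphisms. *)
Definition MW_prod k l m (v : MW k) (w : MW l) : MW m :=
  epsilon (inhabits (MW_zero m)) (fun z =>
    exists a b, [/\ represents a v, represents b w & represents (a * b) z]).

Definition MW_w (w : MW 0) : int := w vertex.

(* For F_1 < ... < F_k this is F_i for 0 <= i <= k + 1, where F_0 is empty and
   F_(k+1) is the ground set. *)
Definition cone_flag k (s : cone k) (i : nat) : {set T} :=
  nth set0 (set0 :: rcons [seq val F | F <- cone_flats s] (ground M)) i.

Definition csm_fun k (s : cone k) : int :=
  (-1) ^+ (dimM - k) *
  \prod_(i < k.+1)
     beta (contraction (restriction M (cone_flag s i.+1)) (cone_flag s i)).

(* That the function [csm_fun] is balanced is a theorem. *)
Definition csm k : MW k :=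
  epsilon (inhabits (MW_zero k)) (fun w => forall s, w s = csm_fun s).

Definition chern1sq : int := MW_w (MW_prod 0 (csm 1) (csm 1)).

Definition chern2 : int := MW_w (csm 0).

End Chow.

(* Main.v *)
(** Call the flats of rank 2 lines, and let k_p be the number of lines through
a point p. The corank of a subset S is an integer combination of the indicators
of [S \subset F], for proper flats F, and of [S = set0]. In the alternating sum
defining beta only the last indicator survives, so its coefficient gives
beta(M) = 3 - 2n + sum_L (|L| - 1) and the weights of csm_1: 2 - k_p on a point
p and 2 - |L| on a line L.

In the Chow ring, x_p x_L has degree 1 if p lies on L, and the linear relations
force x_p^2 and x_L^2 to have degrees 1 - k_p and -1. Conversely, the quadratic
form with these values vanishes on the ideal, so a degree map exists. With
alpha = sum_(F containing i0) x_F, the class 3 alpha - sum_F rk(F) x_F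
represents csm_1, whence c_1^2 = 9 - 5n + sum_L (3|L| - 4).

Since sum_L |L|(|L| - 1) = n(n - 1), the upper bounds hold line by line, with
equality when all lines have two points. For the lower bounds, fix a line L with
m points: the lines other than L satisfy sum (|L'| - 1) >= m(n - m), which makes
c_2 at least (m - 2)(n - m - 1), and c_1^2 at least (2m - 5)(n - m - 1). This
settles all cases but that of c_1^2 when every line has two points, where
c_1^2 = (n - 3)^2. *)

From HB Require Import structures.
From Stdlib Require Import ClassicalEpsilon.
Require Import Defs.
From mathcomp Require Import all_boot all_order all_algebra.
From mathcomp Require Import ring_quotient mpoly boolp zify ring.

Set Implicit Arguments.
Unset Strict Implicit.
Unset Printing Implicit Defensive.
Import Order.TTheory GRing.Theory Num.Theory.
Local Open Scope ring_scope.
Local Open Scope quotient_scope.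

(** * Beta invariants and lines of a simple matroid of rank 3 *)

(** Expand the product over all [i] of [F i + 1], with [F] equal to -1 on [A] and 0 elsewhere: only
    subsets of [A] survive, and any element of [A] gives a zero factor. *)
Lemma sum_sign_subset (T : finType) (A : {set T}) :
  \sum_(S : {set T} | S \subset A) (-1) ^+ #|S| = (A == set0)%:R :> int.
Proof.
pose F i : int := if i \in A then -1 else 0.
transitivity (\prod_i (F i + 1)); last first.
  have [A0|[a aA]] := set_0Vmem A.
    by rewrite A0 eqxx big1 // => i _; rewrite /F A0 in_set0 add0r.
  rewrite (bigD1 a) //= /F aA addNr mul0r.
  by case: eqP aA => // ->; rewrite in_set0.
rewrite bigA_distr big_mkcond; apply: eq_bigr => S _ /=.
rewrite -big_mkcond /=; case: ifPn => [/subsetP SA|].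
  rewrite (eq_bigr (fun=> -1)) ?prodr_const // => i iS.
  by rewrite /F SA.
by case/subsetPn => i iS iA; rewrite (bigD1 i) //= /F (negPf iA) mul0r.
Qed.

(* The alternating sum of [S \subset A] over all S vanishes unless A is empty. *)
Lemma beta_indicators (T : finType) (N : matroid T) (I : finType) (P : pred I)
    (c0 : int) (c : I -> int) (A : I -> {set T}) :
  ground N != set0 ->
  (forall i, P i -> (A i != set0) && (A i \subset ground N)) ->
  (forall S : {set T}, S \subset ground N -> (rank N)%:R - (rk N S)%:R
     = \sum_(i | P i) c i * (S \subset A i)%:R + c0 * (S == set0)%:R) ->
  beta N = - (-1) ^+ rank N * c0.
Proof.
move=> E0 hA hr; rewrite /beta mulNr -mulrN; congr (_ * _).
transitivity (\sum_(S : {set T} | S \subset ground N) ((-1) ^+ #|S| * (rank N)%:R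
   - ((-1) ^+ #|S| * (S == set0)%:R * c0
   + \sum_(i | P i) (-1) ^+ #|S| * (S \subset A i)%:R * c i))).
  apply: eq_bigr => S SE; rewrite -[(rk N S)%:R](subKr (rank N)%:R) hr //.
  rewrite mulrBr mulrDr mulr_sumr [X in _ - X]addrC; congr (_ - (_ + _)).
    by rewrite -mulrA [c0 * _]mulrC.
  by apply: eq_bigr => i _; rewrite [c i * _]mulrC mulrA.
rewrite sumrB -mulr_suml sum_sign_subset (negPf E0) mul0r sub0r; congr (- _).
rewrite big_split /= -[RHS]addr0; congr (_ + _).
  rewrite (bigD1 set0) ?sub0set //= eqxx cards0 !mul1r big1 ?addr0 //.
  by move=> S /andP[_ /negPf->]; rewrite mulr0 mul0r.
rewrite exchange_big big1 //= => i Pi; have /andP[A0 AE] := hA i Pi.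
rewrite -mulr_suml.
rewrite (_ : \sum_(S | _) _ = \sum_(S : {set T} | S \subset A i) (-1) ^+ #|S|).
  by rewrite sum_sign_subset (negPf A0) mul0r.
rewrite big_mkcond [RHS]big_mkcond; apply: eq_bigr => S _.
case: (boolP (S \subset A i)) => [h|_]; last by rewrite mulr0 if_same.
by rewrite (subset_trans h AE) mulr1.
Qed.

Section Geometry.
Variables (T : finType) (M : matroid T).
Hypothesis M_simple : simple_matroid M.
Implicit Types (i j k : T) (L F S : {set T}).
Local Notation E := (ground M).

Definition lines : {set {set T}} := [set L | flat M L & rk M L == 2].

Lemma rk0 : rk M set0 = 0%N.
Proof. by have := @rk_card _ M set0 (sub0set _); rewrite cards0 leqn0 => /eqP. Qed.

Lemma rk_point i : i \in E -> rk M [set i] = 1%N.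
Proof.
move=> iE; have := @rk_card _ M [set i]; rewrite sub1set cards1 => /(_ iE).
have := proj1 M_simple i; rewrite /loop iE /=; lia.
Qed.

Lemma rk_pair i j : i \in E -> j \in E -> i != j -> rk M [set i; j] = 2%N.
Proof.
move=> iE jE ij; have sE : [set i; j] \subset E by rewrite subUset !sub1set iE.
have := rk_card sE; rewrite cards2 ij.
have := @rk_mono _ M [set i] [set i; j]; rewrite subsetUl rk_point // => /(_ isT sE).
have := proj2 M_simple i j; rewrite /parallel iE jE ij /=; lia.
Qed.

Lemma rk_ge2 S i j : S \subset E -> i \in S -> j \in S -> i != j -> (2 <= rk M S)%N.
Proof.
move=> SE iS jS ij; rewrite -(@rk_pair i j) ?(subsetP SE) //.
by apply: rk_mono => //; rewrite subUset !sub1set iS.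
Qed.

Lemma flat_sub F : flat M F -> F \subset E.
Proof. by case/andP. Qed.

Lemma flat_rk F k : flat M F -> k \in E -> k \notin F -> (rk M F < rk M (k |: F))%N.
Proof. by case/andP => _ /forall_inP h kE kF; apply: h; rewrite inE kF. Qed.

Lemma line_flat L : L \in lines -> flat M L.
Proof. by rewrite inE => /andP[]. Qed.

Lemma line_rk L : L \in lines -> rk M L = 2%N.
Proof. by rewrite inE => /andP[_ /eqP]. Qed.

Lemma line_sub L : L \in lines -> L \subset E.
Proof. by move/line_flat/flat_sub. Qed.

Lemma line_card L : L \in lines -> (2 <= #|L|)%N.
Proof. by move=> hL; rewrite -(line_rk hL); apply: rk_card; apply: line_sub. Qed.

Hypothesis M_rank : rank M = 3%N.

Lemma rk_le3 S : S \subset E -> (rk M S <= 3)%N.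
Proof. by move=> SE; rewrite -M_rank; apply: rk_mono. Qed.

Lemma line_proper L : L \in lines -> L \proper E.
Proof.
move=> hL; rewrite properEneq line_sub // andbT; apply/eqP => LE.
by have := line_rk hL; rewrite LE -/(rank M) M_rank.
Qed.

(** If [S] has a point [k] off [L], apply submodularity to [L] and [{k, i, j}]: the union has rank
    above 2 by flatness and the intersection is [{i, j}], of rank 2, so [{k, i, j}] already has rank
    3. *)
Lemma rk_off_line L S i j : L \in lines -> i \in L -> j \in L -> i != j ->
  S \subset E -> i \in S -> j \in S -> rk M S = (2 + ~~ (S \subset L))%N.
Proof.
move=> hL iL jL ij SE iS jS; apply/eqP; rewrite eqn_leq.
have S2 := rk_ge2 SE iS jS ij; have LE := line_sub hL.
case: (boolP (S \subset L)) => [SL|].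
  by rewrite addn0 S2 andbT -(line_rk hL) rk_mono.
case/subsetPn => k kS kL; rewrite rk_le3 //=.
have kE := subsetP SE _ kS.
have AE : k |: [set i; j] \subset E by rewrite !subUset !sub1set kE !(subsetP LE).
have := rk_submod LE AE; have := flat_rk (line_flat hL) kE kL; rewrite line_rk //.
have -> : L :|: (k |: [set i; j]) = k |: L.
  apply/setP => x; rewrite !inE; case: (eqVneq x i) => [->|_]; first by rewrite iL !orbT.
  by case: (eqVneq x j) => [->|_]; rewrite ?jL ?orbT // !orbF orbC.
have -> : L :&: (k |: [set i; j]) = [set i; j].
  apply/setP => x; rewrite !inE; case: (eqVneq x i) => [->|_]; first by rewrite iL !orbT.
  case: (eqVneq x j) => [->|_]; first by rewrite jL !orbT.
  by rewrite !orbF; case: eqP => [->|]; rewrite ?andbF // (negPf kL).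
rewrite rk_pair ?(subsetP LE) //.
have : (rk M (k |: [set i; j]) <= rk M S)%N.
  by apply: rk_mono => //; rewrite !subUset !sub1set kS iS jS.
by move=> leS lt2; rewrite addnC leq_add2l => /(leq_trans lt2)/leq_trans; apply.
Qed.

(** A set of maximal size among those of rank at most 2 containing [i] and [j] is a flat, since
    adding a point must raise its rank. *)
Lemma line_through i j : i \in E -> j \in E -> i != j ->
  exists2 L, L \in lines & (i \in L) && (j \in L).
Proof.
move=> iE jE ij.
pose P (A : {set T}) := [&& A \subset E, i \in A, j \in A & (rk M A <= 2)%N].
have P0 : P [set i; j] by rewrite /P subUset !sub1set iE jE !inE !eqxx orbT rk_pair.
case: (@arg_maxnP _ _ P (fun A => #|A|) P0) => L /and4P[LE iL jL rL] maxL.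
have rL2 : rk M L = 2%N by apply/eqP; rewrite eqn_leq rL (rk_ge2 LE iL jL ij).
exists L; last by rewrite iL.
rewrite inE rL2 eqxx andbT /flat LE; apply/forall_inP => k; rewrite inE => /andP[kL kE].
rewrite rL2 ltnNge; apply/negP => rk2.
have /maxL : P (k |: L).
  by rewrite /P subUset sub1set kE LE !inE iL jL !orbT.
by rewrite /= cardsU1 kL; lia.
Qed.

(** Each line has rank 2 and shares [i] and [j] with the other, so [rk_off_line] applied both ways
    gives both inclusions. *)
Lemma line_unique L L' i j : L \in lines -> L' \in lines -> i != j ->
  i \in L -> j \in L -> i \in L' -> j \in L' -> L = L'.
Proof.
move=> hL hL' ij iL jL iL' jL'; apply/eqP; rewrite eqEsubset.
have := rk_off_line hL iL jL ij (line_sub hL') iL' jL'.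
have := rk_off_line hL' iL' jL' ij (line_sub hL) iL jL.
rewrite !line_rk //; lia.
Qed.

Lemma sum_lines_pair (V : nmodType) (g : {set T} -> V) L i j :
  L \in lines -> i \in L -> j \in L -> i != j ->
  \sum_(L' in lines | (i \in L') && (j \in L')) g L' = g L.
Proof.
move=> hL iL jL ij; rewrite (big_pred1 L) // => L' /=.
apply/idP/eqP => [/and3P[hL' iL' jL']|->]; last by rewrite hL iL.
exact: line_unique ij _ _ _ _.
Qed.

Lemma card_lines_pair i j : i \in E -> j \in E -> i != j ->
  \sum_(L in lines | i \in L) (j \in L)%:R = 1 :> int.
Proof.
move=> iE jE ij; have [L hL /andP[iL jL]] := line_through iE jE ij.
under eq_bigr do rewrite mulrb.
rewrite -big_mkcondr /=.
transitivity (\sum_(L' in lines | (i \in L') && (j \in L')) 1 : int).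
  by apply: eq_bigl => L'; rewrite andbA.
exact: (@sum_lines_pair _ (fun=> 1) L i j hL iL jL ij).
Qed.

(** Only the line through [i] and [j] can contain [S], and it does so exactly when the rank is 2.
    This provides the indicator expansion of the corank, as [beta_indicators] needs it, for sets
    with two points. *)
Lemma rk_codim_lines S i j : S \subset E -> i \in S -> j \in S -> i != j ->
  3 - (rk M S)%:R = \sum_(L in lines) (S \subset L)%:R :> int.
Proof.
move=> SE iS jS ij.
have [L hL /andP[iL jL]] := line_through (subsetP SE _ iS) (subsetP SE _ jS) ij.
rewrite (rk_off_line hL iL jL ij SE iS jS).
rewrite (bigD1 L) //= big1 ?addr0; first by case: (S \subset L).
move=> L' /andP[hL' LL']; case: (boolP (S \subset L')) => // /subsetP SL'.
by rewrite (@line_unique L' L i j) ?SL' ?eqxx in LL'.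
Qed.

Definition pencil i : int := \sum_(L in lines | i \in L) 1.

(** The lines through [i] partition the remaining points of [E]. *)
Lemma sum_pencil i : i \in E ->
  \sum_(L in lines | i \in L) (#|L|%:R - 1) = #|E|%:R - 1 :> int.
Proof.
move=> iE.
transitivity (\sum_(L in lines | i \in L) \sum_(j in E :\ i) (j \in L)%:R : int).
  apply: eq_bigr => L /andP[hL iL].
  under [RHS]eq_bigr do rewrite mulrb.
  rewrite -big_mkcondr (eq_bigl (mem (L :\ i))) /= => [|j]; last first.
    rewrite !inE; case: (boolP (j \in L)) => [/(subsetP (line_sub hL))->|].
      by rewrite !andbT.
    by rewrite !andbF.
  by rewrite sumr_const (cardsD1 i L) iL natrD addrAC subrr add0r.
rewrite exchange_big (eq_bigr (fun=> 1)) /=; last first.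
  by move=> j; rewrite !inE => /andP[ji jE]; rewrite card_lines_pair // eq_sym.
by rewrite sumr_const (cardsD1 i E) iE natrD addrAC subrr add0r.
Qed.

Lemma sum_incidences (V : nmodType) (g : T -> {set T} -> V) :
  \sum_(L in lines) \sum_(i in L) g i L
  = \sum_(i in E) \sum_(L in lines | i \in L) g i L.
Proof.
rewrite (exchange_big_dep (mem E)) //= => L i hL; exact/subsetP/line_sub.
Qed.

Lemma sum_line_card (g : {set T} -> int) :
  \sum_(L in lines) #|L|%:R * g L = \sum_(i in E) \sum_(L in lines | i \in L) g L.
Proof.
rewrite -(sum_incidences (fun=> g)); apply: eq_bigr => L _.
by rewrite sumr_const mulr_natl.
Qed.

Lemma sum_pencils : \sum_(i in E) pencil i = \sum_(L in lines) #|L|%:R.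
Proof.
by rewrite -(sum_line_card (fun=> 1)); apply: eq_bigr => L _; rewrite mulr1.
Qed.

End Geometry.

(** * Proper flats in rank 3: points and lines *)

Section ProperFlats.
Variables (T : finType) (M : matroid T).
Hypotheses (M_simple : simple_matroid M) (M_rank : rank M = 3%N).
Implicit Types (i j k : T) (L F G S : {set T}).
Local Notation E := (ground M).

(** The predicate underlying the subtype [pflat], kept on plain sets so that sums over [pflat] can
    be split into points and lines. *)
Definition proper_flat F := [&& flat M F, F != set0 & F != E].

Lemma ground_gt2 : (2 < #|E|)%N.
Proof. by rewrite -M_rank; apply: rk_card. Qed.

Lemma proper_flat_point i : i \in E -> proper_flat [set i].
Proof.
move=> iE; apply/and3P; split; last first.
- by apply/eqP => h; have := ground_gt2; rewrite -h cards1.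
- by apply/set0Pn; exists i; rewrite inE.
rewrite /flat sub1set iE; apply/forall_inP => j; rewrite !inE => /andP[ji jE].
by rewrite rk_point // rk_pair.
Qed.

Lemma proper_flat_line L : L \in lines M -> proper_flat L.
Proof.
move=> hL; rewrite /proper_flat line_flat //=.
have := line_proper M_rank hL; rewrite properEneq => /andP[-> _]; rewrite andbT.
by apply/eqP => h; have := line_card hL; rewrite h cards0.
Qed.

(** A flat of rank 3 absorbs all of [E], and a set of rank below 2 cannot contain two distinct
    points. *)
Lemma proper_flatP F :
  reflect ((exists2 i, i \in E & F = [set i]) \/ F \in lines M) (proper_flat F).
Proof.
apply: (iffP idP) => [|[[i iE ->]|]]; last 2 first.
- exact: proper_flat_point.
- exact: proper_flat_line.
case/and3P => fF /set0Pn[i iF] FE; have sF := flat_sub fF.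
have iE := subsetP sF _ iF.
have := rk_le3 M_rank sF; rewrite leq_eqVlt => /orP[/eqP r3|].
  case/negP: FE; rewrite eqEsubset sF /=; apply/subsetP => j jE.
  apply/negPn/negP => jF; have := flat_rk fF jE jF.
  by rewrite r3 ltnNge rk_le3 // subUset sub1set jE.
rewrite ltnS leq_eqVlt => /orP[r2|r1]; first by right; rewrite inE fF.
left; exists i => //; apply/eqP; rewrite eqEsubset sub1set iF andbT.
apply/subsetP => j jF; rewrite inE; apply/negPn/negP => ji.
by have := rk_ge2 M_simple sF jF iF ji; rewrite leqNgt r1.
Qed.

Lemma line_neq_point L i : L \in lines M -> (L == [set i]) = false.
Proof. by move/line_card => h; apply/eqP => e; rewrite e cards1 in h. Qed.

Lemma sum_proper_flat (V : nmodType) (g : {set T} -> V) :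
  \sum_(F | proper_flat F) g F = \sum_(i in E) g [set i] + \sum_(L in lines M) g L.
Proof.
rewrite (bigID (mem (lines M))) /= addrC; congr (_ + _); last first.
  apply: eq_bigl => F; rewrite andbC; case: (boolP (F \in lines M)) => //=.
  exact: proper_flat_line.
rewrite -(@big_imset _ _ _ _ _ (@set1 T) (mem E) g) /=; last by move=> i j _ _ /set1_inj.
apply: eq_bigl => F; apply/andP/imsetP => [[/proper_flatP[[i iE ->]|->]] // _|[i iE ->]].
  by exists i.
split; first exact: proper_flat_point.
by apply/negP => /(line_neq_point i); rewrite eqxx.
Qed.

Lemma sum_pflat (V : nmodType) (g : {set T} -> V) :
  \sum_(F : pflat M) g (val F) = \sum_(i in E) g [set i] + \sum_(L in lines M) g L.
Proof. by rewrite -sum_proper_flat; exact/esym/(big_sub proper_flat). Qed.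

(** The value of the first CSM cycle on the ray of [F]. Lines through a point are counted by
    inclusion, so that one function of sets covers points and lines. *)
Definition flat_weight F : int :=
  2 - (if rk M F == 1%N then \sum_(L in lines M | F \subset L) 1 else #|F|%:R).

Lemma flat_weight_point i : i \in E -> flat_weight [set i] = 2 - pencil M i.
Proof.
by move=> iE; rewrite /flat_weight rk_point //; under eq_bigl do rewrite sub1set.
Qed.

Lemma flat_weight_line L : L \in lines M -> flat_weight L = 2 - #|L|%:R.
Proof. by move=> hL; rewrite /flat_weight line_rk. Qed.

End ProperFlats.

(** * Beta invariants of the minors occurring in CSM cycles *)

Section BetaMinors.
Variables (T : finType) (M : matroid T).
Hypotheses (M_simple : simple_matroid M) (M_rank : rank M = 3%N).
Implicit Types (i j k : T) (L F G S : {set T}).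
Local Notation E := (ground M).

Definition minor F G := contraction (restriction M G) F.

Lemma minor_ground F G : G \subset E -> ground (minor F G) = G :\: F.
Proof. by move=> GE; rewrite /= (setIidPr GE). Qed.

Lemma minor_rk F G S : F \subset G -> G \subset E ->
  rk (minor F G) S = (rk M (S :|: F) - rk M F)%N.
Proof.
by move=> FG GE; rewrite /= /contraction_rk /= (setIidPr GE) (setIidPr FG).
Qed.

Lemma minor_rank F G : F \subset G -> G \subset E ->
  rank (minor F G) = (rk M G - rk M F)%N.
Proof.
move=> FG GE; rewrite /rank minor_rk // minor_ground //; congr (rk M _ - _)%N.
by apply/setP => x; rewrite !inE; case: (boolP (x \in F)) => [/(subsetP FG)->|]; rewrite ?orbF.
Qed.

Lemma beta_minor_point i : i \in E -> beta (minor set0 [set i]) = 1.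
Proof.
move=> iE; have sE : [set i] \subset E by rewrite sub1set.
(* A loopless matroid of rank 1 has corank equal to the indicator of the empty set, so the family of
   flats is empty and its data are dummies. *)
rewrite (@beta_indicators _ _ T pred0 1 (fun=> 0) (fun=> set0)) //.
- by rewrite minor_rank // ?sub0set // rk0 rk_point.
- by rewrite minor_ground // setD0; apply/set0Pn; exists i; rewrite inE.
move=> S; rewrite minor_rank ?minor_ground ?sub0set // setD0 minor_rk ?sub0set //.
rewrite setU0 rk0 !subn0 rk_point // big_pred0_eq add0r mul1r subset1.
case/orP => /eqP->; first by rewrite rk_point // -cards_eq0 cards1.
by rewrite rk0 eqxx.
Qed.

(** In rank 2 the corank of a nonempty set is 1 exactly when it is a single point, so points get
    coefficient 1. The empty set, of corank 2, then forces the constant [2 - #|L|]. *)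
Lemma beta_minor_line L : L \in lines M -> beta (minor set0 L) = #|L|%:R - 2.
Proof.
move=> hL; have sE := line_sub hL.
have rL := line_rk hL.
rewrite (@beta_indicators _ _ T (fun i => i \in L) (2 - #|L|%:R) (fun=> 1) (fun i => [set i])) //.
- by rewrite minor_rank // ?sub0set // rk0 rL; ring.
- rewrite minor_ground // setD0; apply/set0Pn/card_gt0P.
  by apply: leq_trans (line_card hL).
- move=> i; rewrite minor_ground // setD0 sub1set => ->.
  rewrite andbT.
  by apply/set0Pn; exists i; rewrite inE.
move=> S; rewrite minor_rank ?minor_ground ?sub0set // setD0 minor_rk ?sub0set //.
rewrite setU0 rk0 !subn0 rL => SL; have SE := subset_trans SL sE.
have [->|[i iS]] := set_0Vmem S.
  rewrite rk0 eqxx (eq_bigr (fun=> 1)) => [|i _]; last by rewrite sub0set mulr1.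
  by rewrite sumr_const mulr1; ring.
have S0 : (S == set0) = false by apply/eqP => h; rewrite h inE in iS.
rewrite S0 mulr0 addr0 (bigD1 i) ?(subsetP SL) //= big1 ?addr0 => [|j /andP[_ ji]]; last first.
  rewrite mul1r; case: (boolP (S \subset _)) => // /subsetP/(_ _ iS); rewrite inE => /eqP h.
  by rewrite h eqxx in ji.
have [Si|] := boolP (S \subset [set i]).
  have -> : S = [set i] by apply/eqP; rewrite eqEsubset Si sub1set.
  by rewrite rk_point ?(subsetP SE).
case/subsetPn => j jS; rewrite inE => ji.
by rewrite (rk_off_line M_simple M_rank hL (subsetP SL _ jS) (subsetP SL _ iS) ji SE jS iS) SL.
Qed.

Lemma beta_minor_over_line L : L \in lines M -> beta (minor L E) = 1.
Proof.
move=> hL; have sE := line_sub hL; have rL := line_rk hL.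
have rE : rk M E = 3%N by [].
rewrite (@beta_indicators _ _ T pred0 1 (fun=> 0) (fun=> set0)) //.
- by rewrite minor_rank // rL rE.
- rewrite minor_ground // setD_eq0; case/properP: (line_proper M_rank hL) => _ [x xE xL].
  by apply/subsetPn; exists x.
move=> S; rewrite minor_rank ?minor_ground // minor_rk //.
rewrite rL rE big_pred0_eq add0r mul1r => SD.
have [->|[i iS]] := set_0Vmem S; first by rewrite set0U rL eqxx.
have S0 : (S == set0) = false by apply/eqP => h; rewrite h inE in iS.
have := subsetP SD _ iS; rewrite inE => /andP[iL iE].
have SLE : S :|: L \subset E by rewrite subUset sE (subset_trans SD) ?subsetDl.
have := flat_rk (line_flat hL) iE iL; rewrite rL S0.
have : (rk M (i |: L) <= rk M (S :|: L))%N by apply: rk_mono; rewrite // setSU // sub1set.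
have := rk_le3 M_rank SLE; lia.
Qed.

(** The same rank 2 computation as for a line, where the sets [L :\ i], for lines [L] through [i],
    take the place of the points. *)
Lemma beta_minor_over_point i : i \in E -> beta (minor [set i] E) = pencil M i - 2.
Proof.
move=> iE; have sE : [set i] \subset E by rewrite sub1set.
have ri := rk_point M_simple iE; have rE : rk M E = 3%N by [].
rewrite (@beta_indicators _ _ {set T} [pred L | (L \in lines M) && (i \in L)]
  (2 - pencil M i) (fun=> 1) (fun L => L :\ i)) //.
- by rewrite minor_rank // ri rE; ring.
- rewrite minor_ground // setD_eq0 subset1; apply/norP; split; last first.
    by apply/eqP => h; have := rE; rewrite h rk0.
  by apply/eqP => h; have := rE; rewrite h ri.
- move=> L /andP[hL iL]; rewrite minor_ground // setSD ?line_sub // andbT.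
  rewrite setD_eq0 subset1 (line_neq_point i hL) /=.
  by apply/eqP => h; rewrite h inE in iL.
move=> S; rewrite minor_rank ?minor_ground // minor_rk //.
rewrite ri rE => /subsetD1P[SE iS].
have [->|[j jS]] := set_0Vmem S.
  rewrite set0U ri eqxx (eq_bigr (fun=> 1)) => [|L _]; last by rewrite sub0set mulr1.
  by rewrite mulr1 subr0 -[X in _ = X + _]/(pencil M i) addrCA subrr addr0.
have S0 : (S == set0) = false by apply/eqP => h; rewrite h inE in jS.
have ij : i != j by apply: contraNneq iS => ->.
have SiE : S :|: [set i] \subset E by rewrite subUset SE.
have iSi : i \in S :|: [set i] by rewrite !inE eqxx orbT.
have jSi : j \in S :|: [set i] by rewrite !inE jS.
have := rk_codim_lines M_simple M_rank SiE iSi jSi ij.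
rewrite S0 mulr0 addr0 => h.
have r2 := rk_ge2 M_simple SiE iSi jSi ij.
(* The rank in the contraction is a truncated difference; [r2] makes it an honest one. *)
transitivity (3 - (rk M (S :|: [set i]))%:R : int); first by lia.
rewrite h [RHS]big_mkcondr; apply: eq_bigr => L _.
rewrite subUset sub1set subsetD1 iS andbT mul1r andbC.
by case: (i \in L).
Qed.

(** Lines get coefficient 1 by [rk_codim_lines]. A singleton has corank 2 and lies on [pencil M i]
    lines, which leaves [2 - pencil M i] for the point. The empty set, of corank 3, then fixes
    [c0]. *)
Lemma beta_minor_all :
  beta (minor set0 E) = 3 - 2 * #|E|%:R + \sum_(L in lines M) (#|L|%:R - 1).
Proof.
have rE : rk M E = 3%N by [].
pose c0 : int := 3 - 2 * #|E|%:R + \sum_(L in lines M) (#|L|%:R - 1).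
rewrite (@beta_indicators _ _ {set T} (proper_flat M) c0
  (fun F => if rk M F == 1%N then flat_weight M F else 1) id) //.
- by rewrite minor_rank ?sub0set // rk0 rE; rewrite /c0; ring.
- rewrite minor_ground // setD0; apply/eqP => h.
  by have := rE; rewrite h rk0.
- by move=> F /and3P[fF F0 _]; rewrite F0 minor_ground // setD0 flat_sub.
move=> S; rewrite minor_rank ?sub0set // minor_ground // minor_rk ?sub0set //.
rewrite setU0 setD0 rk0 !subn0 rE => SE.
rewrite sum_proper_flat //.
have -> : \sum_(L in lines M)
    (if rk M L == 1%N then flat_weight M L else 1) * (S \subset L)%:R
  = \sum_(L in lines M) (S \subset L)%:R.
  by apply: eq_bigr => L hL; rewrite line_rk // mul1r.
have -> : \sum_(i in E)
    (if rk M [set i] == 1%N then flat_weight M [set i] else 1) * (S \subset [set i])%:R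
  = \sum_(i in E) (2 - pencil M i) * (S \subset [set i])%:R.
  by apply: eq_bigr => i iE; rewrite rk_point //= flat_weight_point.
have [->|[i iS]] := set_0Vmem S.
  rewrite rk0 eqxx (eq_bigr (fun i => 2 - pencil M i)) => [|i _]; last by rewrite sub0set mulr1.
  rewrite [\sum_(L in lines M) _](eq_bigr (fun=> 1)) => [|i _]; last by rewrite sub0set.
  by rewrite sumrB sum_pencils /c0 sumrB !sumr_const mulr1; ring.
have S0 : (S == set0) = false by apply/eqP => h; rewrite h inE in iS.
have iE := subsetP SE _ iS.
rewrite S0 mulr0 addr0 (bigD1 i) //= big1 ?addr0 => [|j /andP[_ ji]]; last first.
  case: (boolP (S \subset _)) => [/subsetP/(_ _ iS)|]; rewrite ?mulr0 // inE => /eqP h.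
  by rewrite h eqxx in ji.
have [Si|] := boolP (S \subset [set i]).
  have -> : S = [set i] by apply/eqP; rewrite eqEsubset Si sub1set.
  have -> : \sum_(L in lines M) ([set i] \subset L)%:R = pencil M i.
    by rewrite /pencil [RHS]big_mkcondr; apply: eq_bigr => L _; rewrite sub1set mulrb.
  by rewrite rk_point // mulr1; ring.
case/subsetPn => j jS; rewrite inE => ji.
by rewrite mulr0 add0r (rk_codim_lines M_simple M_rank SE jS iS ji).
Qed.

(** The minus sign is the factor [(-1) ^+ (d - k)] of [csm_fun] for d = 2 and k = 1. *)
Lemma beta_minor_flag F : proper_flat M F ->
  - (beta (minor set0 F) * beta (minor F E)) = flat_weight M F.
Proof.
case/(proper_flatP M_simple M_rank) => [[i iE ->]|hL].
  by rewrite beta_minor_point // beta_minor_over_point // flat_weight_point //; ring.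
by rewrite beta_minor_line // beta_minor_over_line // flat_weight_line //; ring.
Qed.

End BetaMinors.

(** * The degree map of the Chow ring *)

Section QuadraticPart.
Variables (m : nat) (B : 'I_m -> 'I_m -> int).
Hypothesis B_sym : forall i j, B i j = B j i.
Implicit Types (p q : {mpoly int[m]}).

(* The restriction [i <= j] makes each monomial occur once. *)
Definition quad_part p : int :=
  \sum_(i < m) \sum_(j < m | (i <= j)%N) B i j * p@_(U_(i) + U_(j)).

Lemma quad_partP c p q : quad_part (c *: p + q) = c * quad_part p + quad_part q.
Proof.
rewrite /quad_part mulr_sumr -big_split; apply: eq_bigr => i _ /=.
rewrite mulr_sumr -big_split; apply: eq_bigr => j _ /=.
by rewrite mcoeffD mcoeffZ mulrDr mulrCA.
Qed.

Lemma quad_part0 : quad_part 0 = 0.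
Proof.
by rewrite /quad_part big1 // => i _; rewrite big1 // => j _; rewrite mcoeff0 mulr0.
Qed.


Lemma mcoeffXD (i j k l : 'I_m) : (i <= j)%N -> (k <= l)%N ->
  ('X_[(U_(k) + U_(l))%MM] : {mpoly int[m]})@_(U_(i) + U_(j)) = ((i == k) && (j == l))%:R.
Proof.
move=> ij kl; rewrite mcoeffX; congr (nat_of_bool _)%:R.
apply/eqP/andP => [/mnmP h|[/eqP-> /eqP->]//].
have := h i; have := h j; have := h k; have := h l; rewrite !mnmDE !mnm1E -!val_eqE /=; lia.
Qed.

Lemma quad_partXX (k l : 'I_m) : quad_part 'X_[(U_(k) + U_(l))%MM] = B k l.
Proof.
wlog kl : k l / (k <= l)%N.
  by move=> h; case/orP: (leq_total k l) => /h //; rewrite addmC B_sym.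
rewrite /quad_part (bigD1 k) //= (bigD1 l) //= mcoeffXD // !eqxx mulr1.
rewrite !big1 ?addr0 // => [i ik|j /andP[kj jl]]; last first.
  by rewrite mcoeffXD // eqxx (negPf jl) mulr0.
by rewrite big1 // => j ij; rewrite mcoeffXD // (negPf ik) mulr0.
Qed.

Lemma quad_part_homog d p : p \is d.-homog -> d != 2 -> quad_part p = 0.
Proof.
move=> hp d2; rewrite /quad_part big1 // => i _; rewrite big1 // => j _.
by rewrite (dhomog_nemf_coeff hp) ?mulr0 //= mdegD !mdeg1 eq_sym.
Qed.

(** Only the linear part of [p] reaches degree 2 after multiplication by a variable; both sides are
    linear in [p], so monomials suffice. *)
Lemma quad_part_mulX p k : quad_part (p * 'X_k) = \sum_i p@_U_(i) * B i k.
Proof.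
elim/mpolyind: p => [|c mm p _ _ IH].
  by rewrite mul0r quad_part0 big1 // => i _; rewrite mcoeff0 mul0r.
rewrite mulrDl -scalerAl quad_partP IH.
under [RHS]eq_bigr do rewrite mcoeffD mcoeffZ mulrDl -mulrA.
rewrite big_split -mulr_sumr /=; congr (c * _ + _).
rewrite -mpolyXD; case: (boolP (mdeg mm == 1%N)) => [/mdeg1P[l /eqP->]|d1].
  rewrite quad_partXX (bigD1 l) //= mcoeffX eqxx mul1r big1 ?addr0 // => i il.
  rewrite mcoeffX; case: eqP => [/mnmP/(_ i)|]; rewrite ?mul0r //.
  by rewrite !mnm1E eqxx eq_sym (negPf il).
rewrite (@quad_part_homog (mdeg mm).+1); first last.
- by rewrite eqSS.
- by rewrite dhomogX /= mdegD mdeg1 addn1.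
rewrite big1 // => i _; rewrite mcoeffX; case: eqP => [h|]; rewrite ?mul0r //.
by rewrite h mdeg1 in d1.
Qed.

End QuadraticPart.

Lemma mpoly_homog1 (m : nat) (p : {mpoly int[m]}) : p \is 1.-homog ->
  p = \sum_i 'X_i *~ p@_U_(i).
Proof.
move=> hp; apply/mpolyP => mm; rewrite raddf_sum /=.
under eq_bigr do rewrite raddfMz /= mcoeffX.
case: (boolP (mdeg mm == 1%N)) => [/mdeg1P[l /eqP->]|d1].
  rewrite (bigD1 l) //= eqxx intz big1 ?addr0 // => i il.
  case: eqP => [/mnmP/(_ i)|]; rewrite ?mul0rz //.
  by rewrite !mnm1E eqxx eq_sym (negPf il).
rewrite (dhomog_nemf_coeff hp) // big1 // => i _; case: eqP => [h|]; rewrite ?mul0rz //.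
by rewrite -h mdeg1 in d1.
Qed.

Lemma additive_sumMz (U : zmodType) (f : U -> int) (I : finType) (c : I -> int) (x : I -> U) :
  (forall a b, f (a + b) = f a + f b) ->
  f (\sum_i x i *~ c i) = \sum_i c i * f (x i).
Proof.
move=> fD; have f0 : f 0 = 0 by apply: (addrI (f 0)); rewrite -fD !addr0.
have fB : zmod_morphism f.
  by move=> a b; apply: (addIr (f b)); rewrite -fD !subrK.
pose fA : {additive U -> int} := HB.pack f (GRing.isZmodMorphism.Build U int f fB).
rewrite -[f _]/(fA _) raddf_sum; apply: eq_bigr => i _.
by rewrite raddfMz mulrC -mulrzr intz.
Qed.

Section Chow.
Variables (T : finType) (M : matroid T).
Implicit Types (p q : chow_poly M) (F G : pflat M) (a b : chow M).

Lemma chow_piM p q : chow_pi (p * q) = chow_pi p * chow_pi q.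
Proof. exact: (rmorphM (\pi_(chow M))). Qed.

Lemma chow_piD p q : chow_pi (p + q) = chow_pi p + chow_pi q.
Proof. exact: (raddfD (\pi_(chow M))). Qed.

Lemma chow_piB p q : chow_pi (p - q) = chow_pi p - chow_pi q.
Proof. exact: (raddfB (\pi_(chow M))). Qed.

Lemma chow_piMz p c : chow_pi (p *~ c) = chow_pi p *~ c.
Proof. exact: (raddfMz (\pi_(chow M))). Qed.

Lemma chow_pi_sum (I : finType) (P : pred I) (g : I -> chow_poly M) :
  chow_pi (\sum_(i | P i) g i) = \sum_(i | P i) chow_pi (g i).
Proof. exact: (raddf_sum (\pi_(chow M))). Qed.

Lemma chow_pi_surj a : exists p, a = chow_pi p.
Proof. by exists (repr a); rewrite /chow_pi reprK. Qed.

Lemma eq_chow_pi p q : chow_pi p = chow_pi q <-> ideal_gen (@chow_rel T M) (p - q).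
Proof.
rewrite /chow_pi; split => [h|h].
  have : p - q \in @chow_ideal T M by rewrite Quotient.idealrBE; apply/eqP.
  by move/asboolP.
apply/eqP; rewrite -Quotient.idealrBE; exact/asboolP.
Qed.

Lemma chow_pi_rel p : chow_rel p -> chow_pi p = 0.
Proof.
move=> hp; have <- : @chow_pi T M 0 = 0.
  by apply: (addrI (chow_pi 0)); rewrite -chow_piD !addr0.
apply/eq_chow_pi; rewrite subr0 -[p]addr0 -[p in p + _]mul1r.
by constructor => //; constructor.
Qed.

End Chow.

(** * Intersection numbers and degrees of quadratic monomials *)

Section Degree.
Variables (T : finType) (M : matroid T).
Hypotheses (M_simple : simple_matroid M) (M_rank : rank M = 3%N).
Implicit Types (i j k : T) (L : {set T}) (F G : pflat M) (a b : chow M).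
Local Notation E := (ground M).

(** The prospective degree of x_A x_B. It is defined before any degree map is known, in order to
    construct one. *)
Definition intersection_number (A B : {set T}) : int :=
  if A == B then
    if rk M A == 1%N then 1 - \sum_(L in lines M | A \subset L) 1 else - 1
  else ((A \subset B) || (B \subset A))%:R.

Lemma intersection_numberC A B : intersection_number A B = intersection_number B A.
Proof. by rewrite /intersection_number eq_sym orbC; case: eqP => // ->. Qed.

Lemma intersection_number_point i : i \in E ->
  intersection_number [set i] [set i] = 1 - pencil M i.
Proof.
move=> iE; rewrite /intersection_number eqxx rk_point //=.
by under eq_bigl do rewrite sub1set.
Qed.

Lemma intersection_number_points i j : i != j ->
  intersection_number [set i] [set j] = 0.
Proof.
move=> ij; rewrite /intersection_number !sub1set !inE [j == i]eq_sym (negPf ij) /=.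
by case: eqP => // /set1_inj e; rewrite e eqxx in ij.
Qed.

Lemma intersection_number_point_line i L : L \in lines M ->
  intersection_number [set i] L = (i \in L)%:R.
Proof.
move=> hL; rewrite /intersection_number eq_sym (line_neq_point i hL) sub1set.
case: (boolP (L \subset [set i])) => [/subset_leq_card|_]; rewrite ?orbF //.
by rewrite cards1 leqNgt (line_card hL).
Qed.

Lemma intersection_number_line L : L \in lines M -> intersection_number L L = - 1.
Proof. by move=> hL; rewrite /intersection_number eqxx line_rk. Qed.

Lemma intersection_number_lines L L' : L \in lines M -> L' \in lines M -> L != L' ->
  intersection_number L L' = 0.
Proof.
move=> hL hL' LL'; rewrite /intersection_number (negPf LL').
have sub_eq A B : A \in lines M -> B \in lines M -> A \subset B -> A = B.
  move=> hA hB AB; have := line_card hA.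
  case/card_gt1P => i [j [iA jA ij]].
  by apply: (line_unique M_simple M_rank hA hB ij); rewrite ?(subsetP AB).
case: (boolP (L \subset L')) => [/(sub_eq _ _ hL hL') e|_]; first by rewrite e eqxx in LL'.
by case: (boolP (L' \subset L)) => [/(sub_eq _ _ hL' hL) e|_] //; rewrite e eqxx in LL'.
Qed.

Lemma pflat_pointVline F : (exists2 i, i \in E & val F = [set i]) \/ val F \in lines M.
Proof. exact/(proper_flatP M_simple M_rank)/(valP F). Qed.

Lemma pflat_sub F : val F \subset E.
Proof. by case/and3P: (valP F) => /flat_sub. Qed.

Lemma sum_pflat_through (V : nmodType) (g : {set T} -> V) i : i \in E ->
  \sum_(F : pflat M | i \in val F) g (val F)
  = g [set i] + \sum_(L in lines M | i \in L) g L.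
Proof.
move=> iE; rewrite big_mkcond.
rewrite (sum_pflat M_simple M_rank (fun A => if i \in A then g A else 0)).
rewrite [X in _ = _ + X]big_mkcondr.
congr (_ + _); rewrite (bigD1 i) //= inE eqxx big1 ?addr0 // => j /andP[_ ji].
by rewrite inE eq_sym (negPf ji).
Qed.

Lemma sum_intersection_number F i : i \in E ->
  \sum_(G : pflat M | i \in val G) intersection_number (val F) (val G)
  = (rk M (val F) == 1%N)%:R.
Proof.
move=> iE; rewrite sum_pflat_through //.
case: (pflat_pointVline F) => [[j jE ->]|hF].
  rewrite rk_point //=.
  under eq_bigr => L /andP[hL _] do rewrite intersection_number_point_line //.
  case: (eqVneq j i) => [->|ji].
    rewrite intersection_number_point // (eq_bigr (fun=> 1)) ?subrK //.
    by move=> L /andP[_ ->].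
  by rewrite intersection_number_points // card_lines_pair // ?add0r // eq_sym.
rewrite line_rk //= intersection_numberC intersection_number_point_line //.
case: (boolP (i \in val F)) => iF.
  rewrite (bigD1 (val F)) ?hF //= intersection_number_line // big1 ?addr0 ?subrr //.
  by move=> L /andP[/andP[hL _]] LF; rewrite intersection_number_lines // eq_sym.
rewrite add0r big1 // => L /andP[hL iL]; rewrite intersection_number_lines //.
by apply: contraNneq iF => e; rewrite -e in iL.
Qed.

Definition intersection_matrix (i j : 'I_#|pflat M|) : int :=
  intersection_number (val (enum_val i)) (val (enum_val j)).

Lemma intersection_matrixC (k l : 'I_#|pflat M|) :
  intersection_matrix k l = intersection_matrix l k.
Proof. exact: intersection_numberC. Qed.

(** Hence the form descends to the Chow ring. By [quad_part_mulX], each multiple of a generator is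
    tested on linear coefficients only. *)
Lemma quad_part_ideal p : ideal_gen (@chow_rel T M) p -> quad_part intersection_matrix p = 0.
Proof.
have qD p1 p2 : quad_part intersection_matrix (p1 + p2)
    = quad_part intersection_matrix p1 + quad_part intersection_matrix p2.
  by rewrite -[p1]scale1r quad_partP mul1r scale1r.
have qS q (P : pred (pflat M)) : quad_part intersection_matrix (q * \sum_(F | P F) xvar F)
    = \sum_(F | P F) \sum_i q@_U_(i) * intersection_number (val (enum_val i)) (val F).
  rewrite mulr_sumr (@big_morph _ _ _ 0 _ 0 _ qD) ?quad_part0 //.
  apply: eq_bigr => F _; rewrite quad_part_mulX; last exact: intersection_matrixC.
  by rewrite /intersection_matrix enum_rankK.
elim=> [|q g r hg _ IH]; first exact: quad_part0.
rewrite qD IH addr0; case: hg => [F G FG GF|i j iE jE].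
  rewrite mulrA quad_part_mulX ?big1 // => [k _|]; last exact: intersection_matrixC.
  case: (eqVneq k (enum_rank F)) => [->|kF].
    rewrite /intersection_matrix !enum_rankK /intersection_number (negPf FG) (negPf GF).
    case: eqP FG => [->|_ _]; last by rewrite mulr0.
    by rewrite subxx.
  (* Every monomial of [q * xvar F] is divisible by the variable of [F], so no other variable occurs
     alone. *)
  rewrite memN_msupp_eq0 ?mul0r // (perm_mem (msuppMX _ _)).
  apply/mapP => -[m _ /mnmP/(_ (enum_rank F))].
  by rewrite mnmDE !mnm1E eqxx (negPf kF).
rewrite mulrBr addrC -scaleN1r quad_partP !qS mulN1r addrC; apply/eqP.
rewrite subr_eq0; apply/eqP.
rewrite exchange_big [RHS]exchange_big; apply: eq_bigr => k _ /=.
by rewrite -!mulr_sumr !sum_intersection_number.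
Qed.

Lemma dimM2 : dimM M = 2.
Proof. by rewrite /dimM M_rank. Qed.

Definition chow_var F : chow M := chow_pi (xvar F).

Lemma chow_monomE (d : nat) (s : cone M d) :
  chow_monom s = \prod_(F <- cone_flats s) chow_var F.
Proof. by []. Qed.

(** The witness evaluates the quadratic form on a chosen representative; by [quad_part_ideal] the
    choice is immaterial. Existence is what gives the [epsilon] in [deg] its defining properties. *)
Lemma degree_map_exists : exists f : chow M -> int, is_degree_map f.
Proof.
pose q := quad_part intersection_matrix.
have qE (p : chow_poly M) : q (repr (chow_pi p)) = q p.
  have : chow_pi (repr (chow_pi p)) = chow_pi p by rewrite /chow_pi reprK.
  move/eq_chow_pi/quad_part_ideal; rewrite addrC -scaleN1r quad_partP mulN1r.
  by move/eqP; rewrite addrC subr_eq0 => /eqP.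
exists (fun a => q (repr a)); split.
- move=> a b; have [p1 ->] := chow_pi_surj a; have [p2 ->] := chow_pi_surj b.
  by rewrite -chow_piD !qE /q -[p1 in LHS]scale1r quad_partP mul1r.
- by move=> k _ d2 [p hp ->]; rewrite qE; apply: quad_part_homog hp _; rewrite -dimM2.
move=> s; rewrite chow_monomE /cone_flats; case: s => -[fs sz] /=.
have : size fs = 2 by rewrite (eqP sz) dimM2.
case: fs sz => [|F [|G [|]]] //= _ _ /andP[FG _].
rewrite big_cons big_cons big_nil mulr1 -chow_piM qE /q quad_part_mulX; last first.
  exact: intersection_matrixC.
rewrite (bigD1 (enum_rank F)) //= mcoeffX eqxx mul1r big1 ?addr0 => [|k kF].
  rewrite /intersection_matrix !enum_rankK /intersection_number.
  by move: (FG); rewrite properEneq => /andP[/negPf-> ->].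
rewrite mcoeffX; case: eqP => [/mnmP/(_ k)|]; rewrite ?mul0r //.
by rewrite !mnm1E eqxx eq_sym (negPf kF).
Qed.

Lemma deg_is_degree_map : is_degree_map (@deg T M).
Proof. exact: epsilon_spec degree_map_exists. Qed.

Lemma degD a b : deg (a + b) = deg a + deg b.
Proof. by case: deg_is_degree_map. Qed.

Lemma deg0 : deg (0 : chow M) = 0.
Proof. by apply: (addrI (@deg T M 0)); rewrite -degD !addr0. Qed.

Lemma deg_sum (I : finType) (P : pred I) (g : I -> chow M) :
  deg (\sum_(i | P i) g i) = \sum_(i | P i) deg (g i).
Proof. by rewrite (@big_morph _ _ _ 0 _ 0 _ degD) ?deg0. Qed.

Lemma deg_flag F G : val F \proper val G -> deg (chow_var F * chow_var G) = 1.
Proof.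
move=> FG; have sz : size [:: F; G] == dimM M by rewrite dimM2.
have st : sorted (fun F G : pflat M => val F \proper val G) (Tuple sz) by rewrite /= FG.
have [_ _ /(_ (exist _ (Tuple sz) st))] := deg_is_degree_map.
by rewrite chow_monomE big_cons big_cons big_nil mulr1.
Qed.

Lemma chow_var_linear i j : i \in E -> j \in E ->
  \sum_(F : pflat M | i \in val F) chow_var F
  = \sum_(F : pflat M | j \in val F) chow_var F.
Proof.
move=> iE jE; apply/eqP; rewrite -subr_eq0 -!chow_pi_sum -chow_piB.
by apply/eqP/chow_pi_rel/chow_linear.
Qed.

Lemma deg_offdiag F G : F != G ->
  deg (chow_var F * chow_var G) = intersection_number (val F) (val G).
Proof.
move=> FG; rewrite /intersection_number val_eqE (negPf FG).
case: (boolP (val F \subset val G)) => [FsG|FnG].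
  by rewrite deg_flag // properEneq val_eqE FG.
case: (boolP (val G \subset val F)) => [GsF|GnF].
  by rewrite mulrC deg_flag // properEneq val_eqE eq_sym FG.
by rewrite -chow_piM chow_pi_rel ?deg0 //; constructor.
Qed.

(* For [F = G], compare the linear relations at a point of G and at a point
   outside G: all other terms are known. *)
Lemma deg_var_var F G :
  deg (chow_var F * chow_var G) = intersection_number (val F) (val G).
Proof.
have [->|] := eqVneq F G; last exact: deg_offdiag.
case/and3P: (valP G) => fG /set0Pn[i iG] GE; have sG := flat_sub fG.
have [j jE jG] : exists2 j, j \in E & j \notin val G.
  by apply/subsetPn; rewrite eqEsubset sG in GE.
have iE := subsetP sG _ iG.
pose D F := deg (chow_var G * chow_var F) - intersection_number (val G) (val F).
have D_off H : H != G -> D H = 0 by move=> HG; rewrite /D deg_offdiag ?subrr // eq_sym.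
have D_linear : \sum_(F : pflat M | i \in val F) D F = \sum_(F : pflat M | j \in val F) D F.
  by rewrite !sumrB !sum_intersection_number // -!deg_sum -!mulr_sumr (chow_var_linear iE jE).
apply/eqP; rewrite -subr_eq0 -/(D G); apply/eqP.
have <- : \sum_(F : pflat M | i \in val F) D F = D G.
  by rewrite (bigD1 G iG) /= big1 ?addr0 // => H /andP[_ /D_off].
by rewrite D_linear big1 // => H jH; apply: D_off; apply: contraNneq jG => <-.
Qed.

End Degree.

(** * Chern numbers *)

Section ChernNumbers.
Variables (T : finType) (M : matroid T).
Hypotheses (M_simple : simple_matroid M) (M_rank : rank M = 3%N).
Implicit Types (i j k : T) (L : {set T}) (F G : pflat M) (a b : chow M).
Local Notation E := (ground M).

Lemma cone0_flats (s : cone M 0) : cone_flats s = [::].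
Proof. by rewrite /cone_flats; case: s => -[[]]. Qed.

Definition ray F : cone M 1 := exist _ [tuple F] isT.

Lemma cone1_ray (s : cone M 1) : exists F, s = ray F.
Proof.
case: s => -[[|F []] sz] st //; exists F; exact/val_inj/val_inj.
Qed.

Lemma csm_fun_vertex : csm_fun (vertex M)
  = 3 - 2 * #|E|%:R + \sum_(L in lines M) (#|L|%:R - 1).
Proof.
rewrite /csm_fun big_ord1 (dimM2 M_rank) /= subn0 sqrrN expr1n mul1r.
exact: beta_minor_all.
Qed.

Lemma csm_fun_ray F : csm_fun (ray F) = flat_weight M (val F).
Proof.
rewrite /csm_fun !big_ord_recl big_ord0 (dimM2 M_rank) /= mulr1 expr1 mulN1r.
exact: (beta_minor_flag M_simple M_rank (valP F)).
Qed.

(** Independence of [i] is the balancing condition at the vertex, read off in coordinate [i]. *)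
Lemma sum_flat_weight i : i \in E ->
  \sum_(F : pflat M | i \in val F) flat_weight M (val F) = 3 - #|E|%:R.
Proof.
move=> iE; rewrite (sum_pflat_through M_simple M_rank) // flat_weight_point //.
rewrite (eq_bigr (fun L => 1 - (#|L|%:R - 1))) => [|L /andP[hL _]]; last first.
  by rewrite flat_weight_line //; ring.
rewrite sumrB sum_pencil // -/(pencil M i); ring.
Qed.

(** The condition starts from [0 = j.+1]. *)
Lemma balanced0_vacuous (w : {ffun cone M 0 -> int}) : balanced w.
Proof. by []. Qed.

Lemma balanced_csm1 : balanced [ffun s : cone M 1 => csm_fun s].
Proof.
move=> [|//] t _.
(* The only cone to test is the vertex, whose [cone_span] is generated by [u_vec E]. *)
have -> : \sum_(F : pflat M) \sum_(s : cone M 1 | perm_eq (cone_flats s) (F :: cone_flats t))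
     ([ffun s => csm_fun s] s)%:~R *: u_vec (val F) = (3 - #|E|%:R)%:~R *: u_vec E.
  transitivity (\sum_(F : pflat M) ((flat_weight M (val F))%:~R : rat) *: u_vec (val F)).
    apply: eq_bigr => F _; rewrite (big_pred1 (ray F)); first by rewrite ffunE csm_fun_ray.
    move=> s; have [G ->] := cone1_ray s; rewrite cone0_flats perm_sym.
    apply/idP/eqP => [/perm_small_eq-/(_ isT) [->] //|/(congr1 (@cone_flats _ _ _)) [->]].
    exact: perm_refl.
  apply/ffunP => i; rewrite sum_ffunE !ffunE.
  under eq_bigr => F _ do rewrite !ffunE.
  (* Coordinates range over the ambient type; outside [E] both sides vanish. *)
  case: (boolP (i \in E)) => iE; last first.
    rewrite big1 => [|F _]; first by rewrite scaler0.
    have /negPf-> : i \notin val F by apply: contra iE; exact/subsetP/pflat_sub.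
    by rewrite scaler0.
  rewrite -(sum_flat_weight iE) rmorph_sum /= scaler_suml [RHS]big_mkcond /=.
  by apply: eq_bigr => F _; case: ifP => _; rewrite ?scaler0.
by rewrite memvZ // memv_span // mem_head.
Qed.

(** [csm] is chosen by [epsilon], so a balanced weight with the values of [csm_fun] must be
    exhibited. *)
Lemma csm0E s : csm M 0 s = csm_fun s.
Proof.
have exw : exists w : MW M 0, forall s, w s = csm_fun s.
  by exists (MinkowskiWeight (@balanced0_vacuous [ffun s => csm_fun s])) => s'; rewrite /= ffunE.
exact: (epsilon_spec (inhabits (MW_zero M 0)) _ exw s).
Qed.

Lemma csm1E s : csm M 1 s = csm_fun s.
Proof.
have exw : exists w : MW M 1, forall s, w s = csm_fun s.
  by exists (MinkowskiWeight balanced_csm1) => s'; rewrite /= ffunE.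
exact: (epsilon_spec (inhabits (MW_zero M 1)) _ exw s).
Qed.

Lemma chern2E : chern2 M = 3 - 2 * #|E|%:R + \sum_(L in lines M) (#|L|%:R - 1).
Proof. by rewrite /chern2 /MW_w csm0E csm_fun_vertex. Qed.

Lemma chow_homog1 a : chow_homog 1 a -> exists c : pflat M -> int,
  a = \sum_F chow_var F *~ c F.
Proof.
case=> p hp ->; exists (fun F => p@_U_(enum_rank F)).
rewrite {1}(mpoly_homog1 hp) chow_pi_sum (reindex (@enum_rank (pflat M))) /=; last first.
  exact/onW_bij/enum_rank_bij.
by apply: eq_bigr => F _; rewrite chow_piMz.
Qed.

Lemma deg_sumMz (c : pflat M -> int) b :
  deg ((\sum_F chow_var F *~ c F) * b) = \sum_F c F * deg (chow_var F * b).
Proof.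
apply: (additive_sumMz (f := fun x => deg (x * b))) => x y.
by rewrite mulrDl degD.
Qed.

Section CsmClass.
Variable i0 : T.
Hypothesis i0E : i0 \in E.

(* The coefficients of 3 alpha - sum_F rk(F) x_F. *)
Definition csm_coef F : int := 3 * (i0 \in val F)%:R - (rk M (val F))%:R.

Definition csm_class : chow M := \sum_F chow_var F *~ csm_coef F.

Lemma csm_coef_sum (g : {set T} -> int) :
  \sum_F csm_coef F * g (val F)
  = 3 * \sum_(F : pflat M | i0 \in val F) g (val F)
    - (\sum_(i in E) g [set i] + 2 * \sum_(L in lines M) g L).
Proof.
under eq_bigr do rewrite mulrBl.
rewrite sumrB; congr (_ - _).
  rewrite mulr_sumr [RHS]big_mkcond; apply: eq_bigr => F _.
  by case: ifP => _; rewrite ?mulr1 // mulr0 mul0r.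
rewrite (sum_pflat M_simple M_rank (fun A => (rk M A)%:R * g A)) mulr_sumr; congr (_ + _).
  by apply: eq_bigr => i iE; rewrite rk_point // mul1r.
by apply: eq_bigr => L hL; rewrite line_rk.
Qed.

Lemma csm_class_homog : chow_homog 1 csm_class.
Proof.
exists (\sum_F xvar F *~ csm_coef F); last first.
  by rewrite chow_pi_sum; apply: eq_bigr => F _; rewrite chow_piMz.
by apply: rpred_sum => F _; apply: rpredMz; rewrite dhomogX /= mdeg1.
Qed.

(** By [csm_coef_sum], a point on k lines gives 3 - ((1 - k) + 2k) = 2 - k, and a line with m points
    gives 0 - (m - 2). *)
Lemma deg_csm_class F : deg (csm_class * chow_var F) = flat_weight M (val F).
Proof.
rewrite deg_sumMz; under eq_bigr do rewrite deg_var_var // intersection_numberC.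
rewrite (csm_coef_sum (intersection_number M (val F))) sum_intersection_number //.
case: (pflat_pointVline M_simple M_rank F) => [[i iE ->]|hF].
  rewrite rk_point // flat_weight_point //= (bigD1 i) //= intersection_number_point //.
  rewrite big1 ?addr0 => [|j /andP[_ ji]]; last by rewrite intersection_number_points // eq_sym.
  have -> : \sum_(L in lines M) intersection_number M [set i] L = pencil M i.
    rewrite /pencil [RHS]big_mkcondr; apply: eq_bigr => L hL.
    by rewrite intersection_number_point_line // mulrb.
  ring.
rewrite line_rk //= flat_weight_line //.
have -> : \sum_(i in E) intersection_number M (val F) [set i] = #|val F|%:R.
  rewrite -sum1_card natr_sum (big_setID (val F)) /= (setIidPr (pflat_sub F)).
  rewrite [X in _ + X]big1 ?addr0 => [|i]; last first.
    by rewrite inE => /andP[/negPf iF _];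
      rewrite intersection_numberC intersection_number_point_line // iF.
  by apply: eq_bigr => i iF; rewrite intersection_numberC intersection_number_point_line // iF.
rewrite (bigD1 (val F)) //= intersection_number_line // big1 => [|L /andP[hL LF]].
  by ring.
by rewrite intersection_number_lines // eq_sym.
Qed.

Lemma represents_csm_class : represents csm_class (csm M 1).
Proof.
split; first by rewrite dimM2 //; exact: csm_class_homog.
move=> s; have [F ->] := cone1_ray s.
by rewrite csm1E csm_fun_ray chow_monomE /= big_seq1 deg_csm_class.
Qed.

Lemma represents_csm1 a : represents a (csm M 1) ->
  chow_homog 1 a /\ forall F, deg (chow_var F * a) = flat_weight M (val F).
Proof.
case; rewrite dimM2 // => ha hs; split=> // F.
by rewrite mulrC -csm_fun_ray -csm1E hs chow_monomE /= big_seq1.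
Qed.

(** [MW_prod] may pick any representatives. Each is a combination of the x_F, and the other enters
    only through its degrees against the x_F, so both can be traded for [csm_class]. *)
Lemma deg_csm1_sqr a b : represents a (csm M 1) -> represents b (csm M 1) ->
  deg (a * b) = \sum_F csm_coef F * flat_weight M (val F).
Proof.
move=> /represents_csm1[/chow_homog1[c ac] ha] /represents_csm1[_ hb].
transitivity (deg (a * csm_class)).
  rewrite ac !deg_sumMz; apply: eq_bigr => F _.
  by rewrite hb [chow_var F * _]mulrC deg_csm_class.
by rewrite mulrC deg_sumMz; apply: eq_bigr => F _; rewrite ha.
Qed.

Lemma MW_prod_csm1 : MW_w (MW_prod 0 (csm M 1) (csm M 1))
  = \sum_F csm_coef F * flat_weight M (val F).
Proof.
(* This witness shows that the property under [epsilon] in [MW_prod] can be satisfied. *)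
pose z := MinkowskiWeight (@balanced0_vacuous
  [ffun s => deg (csm_class * csm_class * chow_monom s)]).
have exz : exists z : MW M 0, exists a b,
    [/\ represents a (csm M 1), represents b (csm M 1) & represents (a * b) z].
  exists z, csm_class, csm_class; split; try exact: represents_csm_class.
  split=> [|s]; last by rewrite /= ffunE.
  rewrite dimM2 //; case: csm_class_homog => p hp ->.
  by exists (p * p); [exact: (dhomogM hp hp) | rewrite chow_piM].
have [a [b [ha hb [_ hz]]]] := epsilon_spec (inhabits (MW_zero M 0)) _ exz.
rewrite /MW_w /MW_prod hz chow_monomE /= big_nil mulr1.
exact: deg_csm1_sqr.
Qed.

End CsmClass.

(** With n points, [csm_coef_sum] gives 3(3 - n) - sum_p (2 - k_p) - 2 sum_L (2 - |L|), and sum_p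
    k_p = sum_L |L|. *)
Lemma chern1sqE : chern1sq M = 9 - 5 * #|E|%:R + \sum_(L in lines M) (3 * #|L|%:R - 4).
Proof.
have [i0 i0E] : exists i, i \in E by apply/card_gt0P; have := ground_gt2 M_rank; lia.
rewrite /chern1sq (MW_prod_csm1 i0E) csm_coef_sum // sum_flat_weight //.
rewrite (eq_bigr (fun i => 2 - pencil M i)) => [|i iE]; last exact: flat_weight_point.
rewrite [\sum_(L in lines M) flat_weight M L](eq_bigr (fun L => 2 - #|L|%:R)); last first.
  by move=> L; exact: flat_weight_line.
rewrite !sumrB sum_pencils -mulr_sumr !sumr_const.
rewrite -[2 *+ #|E|]mulr_natr -[_ *+ #|lines M|]mulr_natr.
by rewrite -[2 *+ _]mulr_natr; ring.
Qed.

End ChernNumbers.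

(** * Inequalities for the Chern numbers *)

Section Bounds.
Variables (T : finType) (M : matroid T).
Hypotheses (M_simple : simple_matroid M) (M_rank : rank M = 3%N).
Implicit Types (i j k : T) (L : {set T}).
Local Notation E := (ground M).

(** Both sides count ordered pairs of distinct points, each pair lying on exactly one line. *)
Lemma sum_line_pairs :
  \sum_(L in lines M) #|L|%:R * (#|L|%:R - 1) = #|E|%:R * (#|E|%:R - 1) :> int.
Proof.
rewrite (sum_line_card M (fun L => #|L|%:R - 1)).
rewrite (eq_bigr (fun=> #|E|%:R - 1)) => [|i iE]; last exact: sum_pencil.
by rewrite sumr_const -[LHS]mulr_natr mulrC.
Qed.

Lemma exists_line : exists L, L \in lines M.
Proof.
have /card_gt1P[i [j [iE jE ij]]] : (1 < #|E|)%N by apply: ltnW; apply: ground_gt2.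
by have [L hL _] := line_through M_simple M_rank iE jE ij; exists L.
Qed.

(* Each point of L lies on other lines L' with sum (|L'| - 1) = n - |L|, and each
   L' meets L at most once. *)
Lemma sum_other_lines L : L \in lines M ->
  #|L|%:R * (#|E|%:R - #|L|%:R) <= \sum_(L' in lines M | L' != L) (#|L'|%:R - 1) :> int.
Proof.
move=> hL.
have -> : #|L|%:R * (#|E|%:R - #|L|%:R) =
    \sum_(L' in lines M | L' != L) \sum_(i in L | i \in L') (#|L'|%:R - 1) :> int.
  rewrite (exchange_big_dep (mem L)) /=; last by move=> ? ? _ /andP[].
  rewrite mulr_natl -sumr_const; apply: eq_bigr => i iL.
  have := sum_pencil M_simple M_rank (subsetP (line_sub hL) _ iL).
  rewrite (bigD1 L) /= ?hL // => /(canRL (addKr _)).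
  rewrite opprB addrC addrA subrK => <-; apply: eq_bigl => L'.
  by rewrite iL /= andbAC.
apply: ler_sum => L' /andP[hL' LL'].
rewrite -[X in X <= _]mulr1.
have c1 : (1 : int) <= #|L'|%:R by have := line_card hL'; lia.
case: (pickP [pred i in L | i \in L']) => [i /andP[/= iL iL']|no]; last first.
  by rewrite big_pred0 ?mul0r ?subr_ge0.
rewrite mulr1 (bigD1 i) /= ?iL // big1 ?addr0 // => j /andP[/andP[jL jL'] ji].
by rewrite (line_unique M_simple M_rank hL' hL ji) ?eqxx in LL'.
Qed.

Lemma chern2_ge0 : 0 <= chern2 M.
Proof.
rewrite chern2E //; have [L hL] := exists_line.
rewrite (bigD1 L) //=; have := sum_other_lines hL.
have := line_card hL; have := proper_card (line_proper M_rank hL).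
set s := \sum_(_ | _) _.
move: s #|L| #|E| => s m n mn m2 h.
(* This product is 3 - 2n + (m - 1) + m(n - m), the lower bound coming from [sum_other_lines]. *)
have : 0 <= (m%:R - 2) * (n%:R - m%:R - 1) :> int by apply: mulr_ge0; lia.
nia.
Qed.

Lemma chern1sq_ge0 : 0 <= chern1sq M.
Proof.
rewrite chern1sqE //.
case: (pickP [pred L in lines M | (2 < #|L|)%N]) => [L /andP[/= hL m3]|no3].
  rewrite (bigD1 L) //=.
  have := sum_other_lines hL; have := proper_card (line_proper M_rank hL).
  (* Termwise 3x - 4 >= 2(x - 1) for x >= 2, which brings in [sum_other_lines]. The bound becomes
     (2m - 5)(n - m - 1), whose first factor is positive because m >= 3. *)
  have : 2 * \sum_(L' in lines M | L' != L) (#|L'|%:R - 1)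
      <= \sum_(L' in lines M | L' != L) (3 * #|L'|%:R - 4) :> int.
    rewrite mulr_sumr; apply: ler_sum => L' /andP[/line_card h _]; lia.
  set s := \sum_(_ | _) (_ - 1); set t := \sum_(_ | _) _.
  move: s t m3; move: #|L| #|E| => m n s t m3 st mn h.
  have : 0 <= (2 * m%:R - 5) * (n%:R - m%:R - 1) :> int by apply: mulr_ge0; lia.
  nia.
(* All lines have two points here, and 3x - 4 = x(x - 1) at x = 2. *)
have -> : \sum_(L in lines M) (3 * #|L|%:R - 4)
    = \sum_(L in lines M) #|L|%:R * (#|L|%:R - 1) :> int.
  apply: eq_bigr => L hL; have := no3 L; rewrite /= hL /=.
  by have := line_card hL; case: #|L| => [|[|[|]]].
rewrite sum_line_pairs.
rewrite (_ : _ + _ = (#|E|%:R - 3) ^+ 2) ?sqr_ge0 //; ring.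
Qed.

Lemma chern1sq_le : chern1sq M <= 9 - 5 * #|E|%:R + #|E|%:R * (#|E|%:R - 1).
Proof.
rewrite chern1sqE // lerD2l -sum_line_pairs; apply: ler_sum => L _.
(* The difference x(x - 1) - (3x - 4) is the square of x - 2. *)
move: (#|L|%:R : int) => x; have := sqr_ge0 (x - 2); lia.
Qed.

(** Termwise 2(x - 1) <= x(x - 1) for x >= 2; doubling avoids halving n(n - 1). *)
Lemma chern2_le : 2 * chern2 M <= 6 - 4 * #|E|%:R + #|E|%:R * (#|E|%:R - 1).
Proof.
rewrite chern2E // -sum_line_pairs.
have : 2 * \sum_(L in lines M) (#|L|%:R - 1)
    <= \sum_(L in lines M) #|L|%:R * (#|L|%:R - 1) :> int.
  rewrite mulr_sumr; apply: ler_sum => L /line_card h.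
  by apply: ler_wpM2r; lia.
lia.
Qed.

Hypothesis lines2 : forall L, L \in lines M -> #|L| = 2.

Lemma chern1sq_generic : chern1sq M = 9 - 5 * #|E|%:R + #|E|%:R * (#|E|%:R - 1).
Proof.
by rewrite chern1sqE // -sum_line_pairs; congr (_ + _); apply: eq_bigr => L /lines2 ->.
Qed.

Lemma chern2_generic : 2 * chern2 M = 6 - 4 * #|E|%:R + #|E|%:R * (#|E|%:R - 1).
Proof.
rewrite chern2E // -sum_line_pairs mulrDr mulr_sumr; congr (_ + _); first by ring.
by apply: eq_bigr => L /lines2 ->.
Qed.

End Bounds.

(** * The uniform matroid as the case of equality *)

Section Uniform3.
Variable n : nat.
Hypothesis n3 : (3 <= n)%N.

Lemma uniform3_rank : rank (uniform_matroid 3 n) = 3%N.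
Proof. by rewrite /rank /= /uniform_rk cardsT card_ord; apply/minn_idPr. Qed.

Lemma uniform3_simple : simple_matroid (uniform_matroid 3 n).
Proof.
split=> [i|i j]; first by rewrite /loop /= /uniform_rk cards1 andbF.
rewrite /parallel /= /uniform_rk cards2.
by case: (i != j); rewrite ?andbF.
Qed.

Lemma uniform3_line_card L : L \in lines (uniform_matroid 3 n) -> #|L| = 2%N.
Proof. by move/line_rk; rewrite /= /uniform_rk /minn; case: ifP. Qed.

End Uniform3.

Theorem proposition1p4 (n : nat) (T : finType) (M : matroid T)
  (card_ground : #|ground M| = n)
  (M_simple : simple_matroid M)
  (M_rank : rank M = 3%N) :
  (0 <= chern1sq M <= chern1sq (uniform_matroid 3 n)) /\
  (0 <= chern2 M <= chern2 (uniform_matroid 3 n)).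
Proof.
have n3 : (3 <= n)%N by rewrite -card_ground; apply: ground_gt2.
have U_simple := uniform3_simple n; have U_rank := uniform3_rank n3.
have c1M := chern1sq_le M_simple M_rank; have c2M := chern2_le M_simple M_rank.
have c1U := chern1sq_generic U_simple U_rank (@uniform3_line_card n).
have c2U := chern2_generic U_simple U_rank (@uniform3_line_card n).
have card_U : #|ground (uniform_matroid 3 n)| = n by rewrite /= cardsT card_ord.
rewrite card_U in c1U c2U; rewrite card_ground in c1M c2M.
rewrite chern1sq_ge0 // chern2_ge0 // c1U c1M /=; split=> //.
(* The estimates for the second Chern number are stated for its double. *)
by rewrite -(ler_pM2l (isT : 0 < 2 :> int)) c2U.
Qed.
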